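(* Let $M=\begin{pmatrix}A&B\\0&C\end{pmatrix}$, the Black--Scholes solution $u$ with linear boundary condition, the semidiscrete solution $U$, the spatial discretization error $\varepsilon_h(t)$ and the spatial truncation error $\delta_h(t)=(\delta_h^L(t),\delta_h^R(t))^{\rm T}$ be as described in the context. Let $h^\ast>0$ be given and assume that on $[S-h^\ast,S]\times[0,T]$ the partial derivative $u_{sss}$ exists and is continuous. Define $$\kappa=4\sigma^2S^3+6rS^2h^\ast,\qquad \eta(t)=\max\{|u_{sss}(\xi,t)|: S-h^\ast\le\xi\le S\}.$$ Assume that $rI+A$ is invertible, $\mu_\infty[rI+A]\le 0$ and $r+\alpha_m+|\beta_m|+|\gamma_m|\le 0$. Then $$|\varepsilon_h(t)|_\infty\le t\cdot\max_{0\le\vartheta\le t}\left\{|\delta_h^L(\vartheta)|_\infty+\kappa\,\eta(\vartheta)\right\}\quad\text{whenever } 0<h_{m+2}\le h^\ast,\ 0<t\le T.$$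
   Context: Let $m\ge 2$ be an integer, let $r>0$, $\sigma\ge 0$, $S>0$, $T>0$ be real, and let $0=s_0<s_1<\dots<s_{m+1}<s_{m+2}=S$ be a (possibly non-uniform) grid with mesh widths $h_j=s_j-s_{j-1}$. $A$ is the real $m\times m$ tridiagonal matrix with diagonal entries $\alpha_1,\dots,\alpha_m$, subdiagonal entries $\beta_2,\dots,\beta_m$ ($\beta_i$ in position $(i,i-1)$) and superdiagonal entries $\gamma_1,\dots,\gamma_{m-1}$ ($\gamma_i$ in position $(i,i+1)$), all given real numbers. $B$ is the real $m\times 2$ matrix whose only possibly nonzero entry is a given real number $\gamma_m$ in position $(m,1)$. $C=\frac{r}{h_{m+2}}\begin{pmatrix}-S & s_{m+1}\\ -S& s_{m+1}\end{pmatrix}$, and $M=\begin{pmatrix}A&B\\0&C\end{pmatrix}$. $u$ is the exact solution on $[0,S]\times[0,T]$ of the Black--Scholes equation $$u_t=\tfrac12\sigma^2s^2u_{ss}+rs\,u_s-ru\qquad(0<s\le S,\ 0<t\le T)$$ with a given initial function $u(\cdot,0)$, a given Dirichlet condition at $s=0$, and the linear boundary condition $u_{ss}(S,t)=0$ for $0<t\le T$. The initial function is assumed smooth, and $u$ is sufficiently regular that $u_t,u_s,u_{ss}$ exist and are continuous on $(0,S]\times[0,T]$ (so that the equation and boundary condition also hold at $t=0$). $U$ is the exact solution of the semidiscrete system $U'(t)=MU(t)+b(t)$ ($0<t\le T$), $U(0)=U_0$, where $U_0=(u(s_1,0),\dots,u(s_{m+2},0))^{\rm T}$ and $b:[0,T]\to\mathbb{R}^{m+2}$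 is a given continuous function coming from the Dirichlet condition at $s=0$; only its first component may be nonzero. Put $u_h(t)=(u(s_1,t),\dots,u(s_{m+2},t))^{\rm T}$. The spatial discretization error is $\varepsilon_h(t)=u_h(t)-U(t)$. The spatial truncation error is $\delta_h(t)=u_h'(t)-Mu_h(t)-b(t)$, partitioned as $\delta_h(t)=\begin{pmatrix}\delta_h^L(t)\\\delta_h^R(t)\end{pmatrix}$ with $\delta_h^L(t)\in\mathbb{R}^m$, $\delta_h^R(t)\in\mathbb{R}^2$. $|\cdot|_\infty$ is the maximum norm of vectors and $\|\cdot\|_\infty$ the induced matrix norm; $I$ is the identity matrix. The logarithmic maximum norm of a square matrix $X=(\xi_{ij})$ is $\mu_\infty[X]=\lim_{t\downarrow 0}\frac{\|I+tX\|_\infty-1}{t}=\max_i\{\xi_{ii}+\sum_{j\ne i}|\xi_{ij}|\}$. *)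

(* Defs.v *)
From HB Require Import structures.
From mathcomp Require Import all_boot all_order all_algebra.
From mathcomp Require Import all_classical all_reals all_analysis.

Set Implicit Arguments.
Unset Strict Implicit.
Unset Printing Implicit Defensive.

Import Order.TTheory GRing.Theory Num.Theory.
Import numFieldNormedType.Exports.

Local Open Scope classical_set_scope.
Local Open Scope ring_scope.

(** ** Derivatives relative to a set *)

(** The functions considered here are meaningful only on a subset [D] of the
    line, so difference quotients use points of [D] only: this is the usual
    derivative at an interior point of an interval and the one-sided derivative
    at an endpoint. *)
Section DeriveIn.
Context {R : realType} {V : normedModType R}.
Implicit Types (D : set R) (f : R -> V) (x : R) (n : nat).

Definition diff_quot f x : R -> V := fun y => (y - x)^-1 *: (f y - f x).

Definition derivable_in D f x : Prop := cvg (diff_quot f x @ within D x^').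

Definition derive_in D f x : V := lim (diff_quot f x @ within D x^').

Definition deriven_in n D f : R -> V := iter n (derive_in D) f.

(** All derivatives of order at most [n] exist at [x]. *)
Definition derivablen_in n D f x : Prop :=
  forall k, (k < n)%N -> derivable_in D (deriven_in k D f) x.

Definition smooth_in D f : Prop :=
  forall n x, D x -> derivablen_in n D f x.

End DeriveIn.

(** ** Maxima and norms *)

(** The maximum of [f] on [D]; the default value 0 is returned when no maximum
    is attained. *)
Definition max_on {R : realType} (D : set R) (f : R -> R) : R :=
  xget 0 [set y | (f @` D) y /\ ubound (f @` D) y].

(** The library norm [`|v|] on matrices is the largest absolute value of an
    entry, i.e. the maximum norm when [v] is a column vector. *)
Definition opnorm_inf {R : realType} {n : nat} (X : 'M[R]_n) : R :=
  sup [set `|X *m v| | v in [set v : 'cV[R]_n | `|v| <= 1]].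

Definition lognorm_inf {R : realType} {n : nat} (X : 'M[R]_n) : R :=
  lim ((opnorm_inf (1%:M + t *: X) - 1) / t @[t --> 0^'+]).

(** ** The semidiscretization *)

(** Grid points and matrix coefficients are numbered as in the mathematical
    notation (the coefficients from 1), whereas the rows and columns of
    matrices are numbered from 0; the values of [s], [alpha], [beta], [gamma]
    at other indices are irrelevant. *)
Section Semidiscretization.
Context {R : realType}.
Variables (m : nat) (r S : R) (s alpha beta gamma : nat -> R).

Definition is_grid : Prop :=
  [/\ s 0%N = 0, s (m + 2)%N = S & forall j, (j < m + 2)%N -> s j < s j.+1].

Definition mesh (j : nat) : R := s j - s j.-1.

Definition matA : 'M[R]_m :=
  \matrix_(i < m, j < m)
    if j == i :> nat then alpha i.+1
    else if i == j.+1 :> nat then beta i.+1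
    else if j == i.+1 :> nat then gamma i.+1
    else 0.

Definition matB : 'M[R]_(m, 2) :=
  \matrix_(i < m, j < 2)
    if (i.+1 == m) && (j == 0 :> nat) then gamma m else 0.

Definition matC : 'M[R]_2 :=
  (r / mesh (m + 2)) *:
    \matrix_(i < 2, j < 2) if j == 0 :> nat then - S else s (m + 1)%N.

Definition matM : 'M[R]_(m + 2) := block_mx matA matB 0 matC.

Definition grid_values (v : R -> R) : 'cV[R]_(m + 2) := \col_i v (s i.+1).

End Semidiscretization.

(** ** The Black-Scholes problem *)
Section BlackScholes.
Context {R : realType}.
Variables (r sigma S T : R) (u : R -> R -> R).

Definition ds (n : nat) (x t : R) : R := deriven_in n `[0, S] (u^~ t) x.

Definition ds_exists (n : nat) (x t : R) : Prop :=
  derivablen_in n `[0, S] (u^~ t) x.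

Definition dt (x t : R) : R := derive_in `[0, T] (u x) t.

Definition dt_exists (x t : R) : Prop := derivable_in `[0, T] (u x) t.

Definition regular_solution : Prop :=
  [/\ forall x t, x \in `]0, S] -> t \in `[0, T] ->
        dt_exists x t /\ ds_exists 2 x t,
      {within `]0, S] `*` `[0, T], continuous (fun p => dt p.1 p.2)},
      {within `]0, S] `*` `[0, T], continuous (fun p => ds 1 p.1 p.2)}
    & {within `]0, S] `*` `[0, T], continuous (fun p => ds 2 p.1 p.2)}].

(** [u] solves the Black-Scholes problem with initial function [u0] and
    Dirichlet data [g]. *)
Definition black_scholes_solution (u0 g : R -> R) : Prop :=
  [/\ forall x t, x \in `]0, S] -> t \in `]0, T] ->
        dt x t = 2^-1 * sigma ^+ 2 * x ^+ 2 * ds 2 x t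
                 + r * x * ds 1 x t - r * u x t,
      forall x, x \in `[0, S] -> u x 0 = u0 x,
      forall t, t \in `]0, T] -> u 0 t = g t
    & forall t, t \in `]0, T] -> ds 2 S t = 0].

Definition third_derivative_regular (hstar : R) : Prop :=
  (forall x t, x \in `[S - hstar, S] -> t \in `[0, T] -> ds_exists 3 x t) /\
  {within `[S - hstar, S] `*` `[0, T], continuous (fun p => ds 3 p.1 p.2)}.

Definition eta_usss (hstar t : R) : R :=
  max_on `[S - hstar, S] (fun xi => `|ds 3 xi t|).

Definition kappa_const (hstar : R) : R :=
  4 * sigma ^+ 2 * S ^+ 3 + 6 * r * S ^+ 2 * hstar.

End BlackScholes.

Definition semidiscrete_solution {R : realType} {n : nat} (T : R)
    (M : 'M[R]_n) (b : R -> 'cV[R]_n) (U0 : 'cV[R]_n) (U : R -> 'cV[R]_n) :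
    Prop :=
  [/\ {within `[0, T], continuous U},
      forall t, t \in `]0, T] -> derivable_in `[0, T] U t /\
        derive_in `[0, T] U t = M *m U t + b t
    & U 0 = U0].

(** ** Errors; [uh] is the exact solution on the grid *)

Definition discretization_error {R : realType} {n : nat}
    (uh U : R -> 'cV[R]_n) (t : R) : 'cV[R]_n := uh t - U t.

Definition truncation_error {R : realType} {n : nat} (T : R) (M : 'M[R]_n)
    (b uh : R -> 'cV[R]_n) (t : R) : 'cV[R]_n :=
  derive_in `[0, T] uh t - M *m uh t - b t.

(* Main.v *)
Require Import Defs.
From HB Require Import structures.
From mathcomp Require Import all_boot all_order all_algebra.
From mathcomp Require Import all_classical all_reals all_analysis.
From mathcomp Require Import ring lra.

Set Implicit Arguments.
Unset Strict Implicit.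
Unset Printing Implicit Defensive.

Import Order.TTheory GRing.Theory Num.Theory.
Import numFieldNormedType.Exports.

Local Open Scope classical_set_scope.
Local Open Scope ring_scope.

(** The error satisfies eps' = M eps + delta with eps(0) = 0. Let e1, e2 be its
    last two components. Both rows of C coincide, so d = e2 - e1 satisfies
    d' = delta_(m+2) - delta_(m+1), while
    e1' = - r e1 + (r s_(m+1) / h_(m+2)) d + delta_(m+1). Because u_ss vanishes
    at S, the two entries of delta^R are O(h_(m+2)) times the maximum of
    |u_sss|, which compensates the factor 1 / h_(m+2). The remaining components
    together with e1 form a system whose matrix has row sums (diagonal entry
    plus moduli of the others) at most - r: for the first m - 1 rows this is the
    logarithmic norm hypothesis, for row m the hypothesis on the last row. All
    bounds come from one comparison principle with a barrier linear in t: where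
    a component reaches t N, the damping - r t N absorbs the forcing by d, which
    also grows linearly in t. *)

(** * Relative derivatives *)

Lemma mx_norm_leP (R : realType) (p q : nat) (v : 'M[R]_(p, q)) (c : R) :
  0 <= c -> (`|v| <= c) <-> (forall i j, `|v i j| <= c).
Proof.
move=> c0; rewrite [`|v|]mx_normrE; split=> [/bigmax_leP[_ H] i j|H].
  exact: (H (i, j)).
by apply/bigmax_leP; split=> // -[i j] _; exact: H.
Qed.

Lemma ler_mx_norm (R : realType) (p q : nat) (v : 'M[R]_(p, q)) i j :
  `|v i j| <= `|v|.
Proof. by have /mx_norm_leP := lexx `|v|; apply. Qed.

Lemma cvg_mx (R : realType) (T : Type) (F : set_system T) (FF : Filter F)
    (p q : nat) (f : T -> 'M[R]_(p, q)) (l : 'M[R]_(p, q)) :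
  (forall i j, (fun x => f x i j) @ F --> l i j) -> f @ F --> l.
Proof.
move=> H; apply/cvgrPdist_le => e e0.
have : \forall x \near F, forall ij : 'I_p * 'I_q,
    `|l ij.1 ij.2 - f x ij.1 ij.2| <= e.
  by apply: filter_forall => -[i j]; move/cvgrPdist_le : (H i j); apply.
apply: filterS => x Hx; apply/mx_norm_leP; first exact: ltW.
by move=> i j; rewrite !mxE; exact: (Hx (i, j)).
Qed.

Lemma cvg_coord (R : realType) (T : Type) (F : set_system T) (FF : Filter F)
    (p q : nat) (f : T -> 'M[R]_(p, q)) (l : 'M[R]_(p, q)) i j :
  f @ F --> l -> (fun x => f x i j) @ F --> l i j.
Proof.
by move=> fl; exact: (cvg_comp _ _ fl (@coord_continuous R p q i j l)).
Qed.

(** A nondegenerate interval accumulates at each of its points, so limits along this filter are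
    unique and determine [derive_in]. *)
Lemma within_dnbhs_itv_proper (R : realType) (a b x : R) :
  a < b -> x \in `[a, b] -> ProperFilter (within `[a, b] x^').
Proof.
move=> ab xab; apply: Build_ProperFilter_ex => P.
rewrite /within /= => /nbhs_ballP[e /= e0 He].
move: xab; rewrite in_itv /= => /andP[ax xb].
have [xltb|] := ltP x b.
  pose d := Num.min (e / 2) (b - x).
  have d0 : 0 < d by rewrite lt_min divr_gt0 //= subr_gt0.
  have dle : d <= e / 2 by rewrite ge_min lexx.
  have dleb : d <= b - x by rewrite ge_min lexx orbT.
  exists (x + d); apply: (He (x + d)) => /=.
  - by rewrite /ball /= ltr_norml; lra.
  - by apply/eqP; lra.
  - by rewrite in_itv /=; lra.
move=> bx.
pose d := Num.min (e / 2) (x - a).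
have d0 : 0 < d by rewrite lt_min divr_gt0 //= subr_gt0; lra.
have dle : d <= e / 2 by rewrite ge_min lexx.
have dleb : d <= x - a by rewrite ge_min lexx orbT.
exists (x - d); apply: (He (x - d)) => /=.
- by rewrite /ball /= ltr_norml; lra.
- by apply/eqP; lra.
- by rewrite in_itv /=; lra.
Qed.

(** The first-order term [(y - x) *: diff_quot f x y] tends to 0; the point [y = x], absent from the
    punctured filter, is treated separately. *)
Lemma derivable_in_continuous (R : realType) (V : normedModType R) (D : set R)
    (f : R -> V) (x : R) :
  derivable_in D f x -> f @ within D (nbhs x) --> f x.
Proof.
move=> df.
have : (fun y => (y - x) *: diff_quot f x y + f x) @ within D x^' --> f x.
  rewrite -[X in _ --> X](add0r (f x)).
  rewrite -(scale0r (derive_in D f x)).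
  apply: cvgD; last exact: cvg_cst.
  apply: cvgZ => //.
  rewrite -(subrr x); apply: cvgB; last exact: cvg_cst.
  by apply: cvg_trans (@nbhs_dnbhs _ x); apply: cvg_within.
move=> H; apply/cvgrPdist_lt => e e0.
move/cvgrPdist_lt : H => /(_ e e0) H.
rewrite near_withinE; rewrite near_withinE /dnbhs near_withinE in H.
near=> y => Dy.
have [->|yx] := eqVneq y x; first by rewrite subrr normr0.
have : y != x -> D y -> `|f x - ((y - x) *: diff_quot f x y + f x)| < e.
  by near: y; exact: H.
move=> /(_ yx Dy); rewrite /diff_quot scalerA divff ?scale1r ?subr_eq0 //.
by rewrite subrK.
Unshelve. all: by end_near. Qed.

(** Near an interior point all increments stay in [D], so the relative derivative is the ordinary
    one. *)
Lemma derivable_in_is_derive (R : realType) (D : set R)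
    (f : R -> R) (x : R) :
  D° x -> derivable_in D f x -> is_derive x 1 f (derive_in D f x).
Proof.
move=> Dx df.
have H : h^-1 *: (f (h *: 1 + x) - f x) @[h --> 0^'] --> derive_in D f x.
  apply/cvgrPdist_lt => e e0; move/cvgrPdist_lt : df => /(_ e e0) H.
  rewrite near_withinE /dnbhs near_withinE in H.
  have : nbhs x (fun y => D y /\ (y != x -> D y ->
      `|derive_in D f x - diff_quot f x y| < e)) by exact: filterI Dx H.
  move=> /nbhs_ballP[d /= d0 Hd].
  rewrite near_withinE; apply/nbhs_ballP; exists d => //= h hd h0.
  have [|Dh Hh] := Hd (h + x).
    by move: hd; rewrite /ball /= !ltr_norml; lra.
  have hx : h + x != x by rewrite -subr_eq0 addrK.
  have := Hh hx Dh; rewrite /diff_quot addrK.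
  by rewrite [h *: 1]mulr1.
by apply: DeriveDef; [apply/cvg_ex; exists (derive_in D f x)|exact: cvg_lim].
Qed.

(** An end of [[c, d]] may be an end of [[a, b]], where only continuity is used. *)
Lemma MVT_in (R : realType) (a b c d : R) (f : R -> R) :
  c < d -> a <= c -> d <= b ->
  (forall x, x \in `[c, d] -> derivable_in `[a, b] f x) ->
  exists2 x, x \in `]c, d[ & f d - f c = derive_in `[a, b] f x * (d - c).
Proof.
move=> cd ac db df; apply: MVT => // [x xcd|].
  apply: derivable_in_is_derive.
    apply: filterS (near_in_itvoo xcd) => y.
    by rewrite /= !in_itv /=; lra.
  by apply: df; move: xcd; rewrite !in_itv /=; lra.
apply/subspace_continuousP => x /= xcd.
apply: cvg_trans (derivable_in_continuous (df x xcd)).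
apply: cvg_app; apply: within_subset.
by move=> y /=; rewrite !in_itv /=; lra.
Qed.

(** At the first time some [f i] reaches the strict barrier
    [(t + e) * (N + e)], its left derivative is at least [N + e]. *)
Lemma barrier (R : realType) (T N : R) (I : finType) (f f' : I -> R -> R) :
  0 <= T -> 0 <= N ->
  (forall i, {within `[0, T], continuous (f i)}) ->
  (forall i, f i 0 <= 0) ->
  (forall i t, 0 < t <= T ->
     diff_quot (f i) t @ within `[0, T] t^' --> f' i t) ->
  (forall i t, 0 < t <= T -> t * N <= f i t ->
     (forall j, f j t <= f i t) -> f' i t <= N) ->
  forall i t, 0 <= t <= T -> f i t <= t * N.
Proof.
move=> T0 N0 fc f0 fd fb.
(* The excess of the raised barrier over [t * N] is [e * (t + N + e)]; the choice of [d] below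
   brings it under any given tolerance. *)
suff H : forall e, 0 < e -> forall i t, 0 <= t <= T ->
    f i t < (t + e) * (N + e).
  move=> i t tT; apply/ler_addgt0Pl => e e0.
  pose d := Num.min 1 (e / (t + N + 1)).
  have d0 : 0 < d by rewrite lt_min ltr01 divr_gt0 //; lra.
  have d1 : d <= 1 by rewrite ge_min lexx.
  have d2 : d * (t + N + 1) <= e.
    by rewrite -ler_pdivlMr; [rewrite ge_min lexx orbT|lra].
  have := H d d0 i t tT.
  have : d * d <= d by nra.
  nra.
move=> e e0.
pose y t := (t + e) * (N + e).
have yc : continuous y.
  move=> x; apply: cvgM; last exact: cvg_cst.
  by apply: cvgD; [exact: cvg_id|exact: cvg_cst].
pose B := [set t | 0 <= t <= T /\ exists i, y t <= f i t].
apply: contrapT => /existsNP[i0] /existsNP[t1] /not_implyP[t1T].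
move/negP; rewrite -leNgt => yft1.
have Bt1 : B t1 by split => //; exists i0.
have Blb : lbound B 0 by move=> t [/andP[]].
have Binf : has_inf B by split; [exists t1|exists 0].
pose t0 := inf B.
have t00 : 0 <= t0 by apply: lb_le_inf => //; exists t1.
have t0t1 : t0 <= t1 by apply: ge_inf => //; exists 0.
have t0T : t0 <= T by lra.
have Hbef i t : 0 <= t < t0 -> f i t < y t.
  move=> tt0; rewrite ltNge; apply/negP => yf.
  have : t0 <= t by apply: ge_inf; [exists 0|split; [lra|exists i]].
  lra.
have fyc i : (fun t => f i t - y t) @ within `[0, T] (nbhs t0)
    --> f i t0 - y t0.
  apply: cvgB.
    by move/subspace_continuousP : (fc i); apply; rewrite /= in_itv /=; lra.
  by apply: cvg_within_filter; exact: yc.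
(* The infimum is attained: otherwise all of the finitely many components stay below the barrier on
   a neighbourhood of [t0], which contains points of [B]. *)
have [i yft0] : exists i, y t0 <= f i t0.
  apply: contrapT => /forallNP H.
  have : \forall t \near within `[0, T] (nbhs t0), forall i, f i t - y t < 0.
    apply: filter_forall => i; apply: (cvgr_lt (f i t0 - y t0)); first exact: fyc.
    by have /negP := H i; rewrite -ltNge; lra.
  rewrite near_withinE => /nbhs_ballP[d /= d0 Hd].
  have [z [z1 z2] z3] := inf_adherent d0 Binf.
  have t0z : t0 <= z by apply: ge_inf => //; exists 0.
  case: z2 => i; rewrite leNgt => /negP; apply.
  rewrite -subr_lt0; apply: (Hd z).
    by rewrite /ball /= ltr_norml; rewrite -/t0 in z3 *; lra.
  by rewrite /= in_itv.
have t0gt : 0 < t0.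
  rewrite lt_neqAle t00 andbT; apply/eqP => t0E; move: yft0; rewrite -t0E.
  have := f0 i; rewrite /y; nra.
(* A component above the barrier at [t0] would by continuity already exceed it slightly earlier. *)
have fy j : f j t0 <= y t0.
  rewrite leNgt; apply/negP => yf.
  have : \forall t \near within `[0, T] (nbhs t0), 0 < f j t - y t.
    by apply: (cvgr_gt (f j t0 - y t0)); [exact: fyc|lra].
  rewrite near_withinE => /nbhs_ballP[d /= d0 Hd].
  pose z := Num.max 0 (t0 - d / 2).
  have z0 : 0 <= z by rewrite le_max lexx.
  have zd : t0 - d / 2 <= z by rewrite le_max lexx orbT.
  have zt : z < t0 by rewrite gt_max t0gt /=; lra.
  have : 0 < f j z - y z.
    apply: (Hd z); first by rewrite /ball /= ltr_norml; lra.
    by rewrite /= in_itv /=; lra.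
  have := Hbef j z; lra.
have fE : f i t0 = y t0 by apply/eqP; rewrite eq_le fy yft0.
have f'N : f' i t0 <= N.
  apply: fb; [lra| |by move=> j; rewrite fE].
  by rewrite fE /y; nra.
have Hd : diff_quot (f i) t0 @ within `[0, T] t0^' --> f' i t0.
  by apply: fd; lra.
(* Just before [t0] the component lies below a line of slope [N + e] that it meets at [t0], so its
   left difference quotients exceed [N + e], against [f'N]. *)
have : \forall t \near within `[0, T] t0^', diff_quot (f i) t0 t < N + e.
  by apply: (cvgr_lt (f' i t0)); [exact: Hd|lra].
rewrite near_withinE /dnbhs near_withinE => /nbhs_ballP[d /= d0 {}Hd].
pose z := Num.max 0 (t0 - d / 2).
have z0 : 0 <= z by rewrite le_max lexx.
have zd : t0 - d / 2 <= z by rewrite le_max lexx orbT.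
have zt : z < t0 by rewrite gt_max t0gt /=; lra.
have : diff_quot (f i) t0 z < N + e.
  apply: (Hd z); first by rewrite /ball /= ltr_norml; lra.
    by apply/eqP; lra.
  by rewrite /= in_itv /=; lra.
have : f i z < y z by apply: Hbef; lra.
rewrite /diff_quot /= fE => H1.
rewrite [_ *: _]mulrC ltr_ndivrMr; last lra.
by rewrite /y in H1 *; nra.
Qed.

(** * Logarithmic norms and maxima *)

(** For such [t] the diagonal of [1%:M + t *: X] is nonnegative, so each absolute row sum is affine
    in [t] and row [k] dominates. *)
Lemma opnorm_inf_near1 (R : realType) (n : nat) (X : 'M[R]_n) (k : 'I_n)
    (t : R) :
  0 < t -> (forall i, t * `|X i i| <= 1) ->
  (forall i, X i i + \sum_(j | j != i) `|X i j|
             <= X k k + \sum_(j | j != k) `|X k j|) ->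
  opnorm_inf (1%:M + t *: X) = 1 + t * (X k k + \sum_(j | j != k) `|X k j|).
Proof.
move=> t0 tX kmax; set mu := X k k + _.
have tXN i : - 1 <= t * X i i.
  have := tX i; rewrite -[X in X * `|_|](gtr0_norm t0) -normrM ler_norml; lra.
have entryE (v : 'cV[R]_n) i : ((1%:M + t *: X) *m v) i 0
    = (1 + t * X i i) * v i 0 + t * \sum_(j | j != i) X i j * v j 0.
  rewrite mxE (bigD1 i) //= !mxE eqxx; congr (_ + _).
  rewrite mulr_sumr; apply: eq_bigr => j ji; rewrite !mxE eq_sym (negbTE ji).
  by rewrite add0r mulrA.
have mu0 : 0 <= 1 + t * mu.
  rewrite /mu mulrDr addrA addr_ge0 //; first by have := tXN k; lra.
  by rewrite mulr_ge0 ?sumr_ge0 // ltW.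
pose E := [set `|(1%:M + t *: X) *m v| | v in [set v : 'cV[R]_n | `|v| <= 1]].
have Eub : ubound E (1 + t * mu).
  move=> _ [v /= v1 <-]; apply/mx_norm_leP => // i j; rewrite ord1 entryE.
  have v1i l : `|v l 0| <= 1 by exact: le_trans (ler_mx_norm _ _ _) v1.
  apply: (@le_trans _ _ ((1 + t * X i i) + t * \sum_(j | j != i) `|X i j|)).
    rewrite (le_trans (ler_normD _ _)) // lerD //.
      rewrite normrM ger0_norm; last by have := tXN i; lra.
      by rewrite ler_piMr //; have := tXN i; lra.
    rewrite normrM gtr0_norm // ler_pM2l //.
    rewrite (le_trans (ler_norm_sum _ _ _)) // ler_sum // => l _.
    by rewrite normrM ler_piMr.
  by have := kmax i; rewrite -/mu => /(ler_wpM2l (ltW t0)); lra.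
have Emax : exists2 x, E x & 1 + t * mu <= x.
  (* This vector, 1 at [k] and the signs of row [k] elsewhere, makes row [k] attain its absolute row
     sum. *)
  pose v : 'cV[R]_n := \col_j if j == k then 1 else Num.sg (X k j).
  exists `|(1%:M + t *: X) *m v|.
    exists v => //=; apply/mx_norm_leP => // i j; rewrite mxE.
    by case: eqP => _; rewrite ?normr1 // normr_sg lern1 leq_b1.
  apply: le_trans (ler_mx_norm _ k 0); rewrite entryE.
  rewrite mxE eqxx mulr1 (eq_bigr (fun j => `|X k j|)); last first.
    by move=> j /negbTE jk; rewrite mxE jk mulrC -normrEsg.
  by rewrite (le_trans _ (ler_norm _)) // /mu; lra.
case: Emax => x Ex mux; apply/eqP; rewrite eq_le; apply/andP; split.
  by apply: ge_sup => //; exists x.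
by apply: (le_trans mux); apply: ub_le_sup => //; exists (1 + t * mu).
Qed.

(** The quotient defining [lognorm_inf] is constant for small [t], hence its
    limit is not a default value. *)
Lemma row_sum_le_lognorm_inf (R : realType) (n : nat) (X : 'M[R]_n) i :
  X i i + \sum_(j | j != i) `|X i j| <= lognorm_inf X.
Proof.
pose mu k := X k k + \sum_(j | j != k) `|X k j|.
have [k _ kmax] : exists2 k, true & forall l, mu l <= mu k.
  by case: (@arg_maxP _ _ _ i xpredT mu isT) => // k _ H; exists k => // l; apply: H.
(* [s] dominates every diagonal modulus, so [t < (s + 1)^-1] meets the smallness condition for all
   rows at once. *)
pose s := \sum_l `|X l l|.
have s0 : 0 <= s by apply: sumr_ge0.
rewrite /lognorm_inf (@lim_near_cst _ _ _ _ _ (mu k)) //; first exact: kmax.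
near=> t.
have t0 : 0 < t by near: t; exact: nbhs_right_gt.
have ts : t < (s + 1)^-1.
  by near: t; apply: nbhs_right_lt; rewrite invr_gt0; lra.
rewrite (@opnorm_inf_near1 _ _ _ k) //.
  by rewrite addrC addKr mulrC mulKf // gt_eqF.
move=> l.
have Xs : `|X l l| <= s by rewrite /s (bigD1 l) //= lerDl sumr_ge0.
have : t * (s + 1) < 1 by rewrite -ltr_pdivlMr ?div1r //; lra.
by have := normr_ge0 (X l l); nra.
Unshelve. all: by end_near. Qed.

(** Attainment of the maximum rules out the default value 0 of [max_on]. *)
Lemma ler_max_on (R : realType) (D : set R) (f : R -> R) (x : R) :
  (exists2 c, D c & forall y, D y -> f y <= f c) -> D x -> f x <= max_on D f.
Proof.
move=> [c Dc cmax] Dx; rewrite /max_on.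
case: xgetP => [y _ [_ ub]|/(_ (f c))[]]; first by apply: ub; exists x.
by split; [exists c|move=> _ [y Dy <-]; exact: cmax].
Qed.

(** A joint maximizer of [F y + k * `|G (x, y)|] shows that [H] attains its
    maximum, without continuity of the fibrewise maximum. *)
Lemma max_on_fibre (R : realType) (a b c d k : R) (F : R -> R)
    (G : R * R -> R) :
  a <= b -> c <= d -> 0 <= k ->
  {within `[c, d], continuous F} -> {within `[a, b] `*` `[c, d], continuous G} ->
  let H := fun y => F y + k * max_on `[a, b] (fun x => `|G (x, y)|) in
  forall x y, x \in `[a, b] -> y \in `[c, d] ->
  F y + k * `|G (x, y)| <= max_on `[c, d] H /\ F y <= max_on `[c, d] H.
Proof.
move=> ab cd k0 Fc Gc H x y xab ycd.
have ne : (`[a, b] `*` `[c, d])%classic !=set0.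
  by exists (a, c); split; rewrite /= in_itv /= lexx.
have co : compact (`[a, b] `*` `[c, d])%classic.
  by apply: compact_setX; exact: segment_compact.
have [|[x0 y0] xy0 /= Hmax] :=
    compact_EVT_max (f := fun q => F q.2 + k * `|G q|) ne co.
  apply/subspace_continuousP => -[p q] [/= pab qcd].
  apply: cvgD.
    move/subspace_continuousP : Fc => /(_ q qcd) Fq.
    apply: cvg_comp Fq => P; rewrite /within /=.
    move=> HP; exists (setT, (fun z => `[c, d]%classic z -> P z)).
      by split; [exact: filterT|exact: HP].
    by move=> z [_ Hz] [_ z2]; exact: Hz.
  apply: cvgM; first exact: cvg_cst.
  by apply: cvg_norm; move/subspace_continuousP : Gc; apply.
move: xy0; rewrite inE => -[/= x0ab y0cd].
have fib z : z \in `[c, d] ->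
    exists2 p, p \in `[a, b] & forall q, q \in `[a, b] -> `|G (q, z)| <= `|G (p, z)|.
  move=> zcd; have [] := @EVT_max R (fun q => `|G (q, z)|) a b ab.
    apply/subspace_continuousP => p pab; apply: cvg_norm.
    move/subspace_continuousP : Gc => /(_ (p, z)) /= Gpz.
    have /Gpz {}Gpz : (`[a, b] `*` `[c, d])%classic (p, z) by [].
    apply: cvg_comp Gpz => P; rewrite /within /= => -[[A B] [/= HA HB] AB].
    apply: filterS HA => q Aq qab; apply: (AB (q, z)) => //.
    by split => //=; exact: nbhs_singleton.
  by move=> p pab pmax; exists p.
(* The value [H z] is attained at some [(p, z)], hence is at most the joint maximum at [(x0, y0)],
   which in turn is at most [H y0]. *)
have Hy0 z : z \in `[c, d] -> H z <= H y0.
  move=> zcd; rewrite /H.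
  have [p pab pmax] := fib z zcd.
  have -> : max_on `[a, b] (fun q => `|G (q, z)|) = `|G (p, z)|.
    rewrite /max_on; case: xgetP => [w _ [[q qab <-] ub]|/(_ `|G (p, z)|)[]].
      by apply/eqP; rewrite eq_le pmax //= ub //; exists p.
    by split; [exists p|move=> _ [q qab <-]; exact: pmax].
  apply: (le_trans (Hmax (p, z) _)); first by rewrite inE.
  rewrite lerD2l ler_wpM2l //.
  exact: (@ler_max_on _ _ (fun q => `|G (q, y0)|) x0 (fib y0 y0cd)).
have Hle : H y <= max_on `[c, d] H.
  by apply: ler_max_on => //; exists y0.
have M := @ler_max_on _ _ (fun q => `|G (q, y)|) x (fib y ycd) xab.
split; apply: le_trans Hle; rewrite /H.
  by rewrite lerD2l ler_wpM2l.
by rewrite lerDl mulr_ge0 //; exact: le_trans M.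
Qed.

(** * Truncation error and stability *)

Local Arguments deriven_in : simpl never.

(** The mean value theorem is applied at three orders, starting from u_ss = 0 at [S]: u_ss is O(h)
    on the last cell, so u_s varies there by O(h^2), and the quotient [D] is itself a value of u_s
    on that cell. *)
Lemma linear_boundary_taylor (R : realType) (S h Q : R) (f : R -> R) :
  0 < h <= S ->
  (forall x, x \in `[S - h, S] -> derivablen_in 3 `[0, S] f x) ->
  deriven_in 2 `[0, S] f S = 0 ->
  (forall x, x \in `[S - h, S] -> `|deriven_in 3 `[0, S] f x| <= Q) ->
  let D := (f S - f (S - h)) / h in
  [/\ `|deriven_in 2 `[0, S] f (S - h)| <= Q * h,
      `|deriven_in 1 `[0, S] f S - D| <= Q * h ^+ 2
    & `|deriven_in 1 `[0, S] f (S - h) - D| <= Q * h ^+ 2].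
Proof.
move=> /andP[h0 hS] df f2S f3 D.
have mvt k x y : (k < 3)%N -> S - h <= x -> x < y -> y <= S ->
    exists2 z, z \in `]x, y[ & deriven_in k `[0, S] f y - deriven_in k `[0, S] f x
      = deriven_in k.+1 `[0, S] f z * (y - x).
  move=> k3 hx xy yS; apply: MVT_in => //; first lra.
  move=> z; rewrite in_itv /= => /andP[xz zy]; apply: df => //.
  by rewrite in_itv /=; apply/andP; split; lra.
have Q0 : 0 <= Q by apply: le_trans (f3 S _); rewrite ?in_itv /=; [|lra].
have f2 x : S - h <= x <= S -> `|deriven_in 2 `[0, S] f x| <= Q * h.
  move=> xS; have [->|xnS] := eqVneq x S.
    by rewrite f2S normr0 mulr_ge0 // ltW.
  have xltS : x < S by rewrite lt_neqAle xnS; lra.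
  have [|z] := mvt 2%N x S isT _ xltS (lexx _); first lra.
  rewrite in_itv /= => /andP[xz zS]; rewrite f2S sub0r => /eqP; rewrite eqr_oppLR => /eqP ->.
  rewrite normrN normrM ler_pM //; last by rewrite ger0_norm; lra.
  by apply: f3; rewrite in_itv /=; apply/andP; split; lra.
have f1 x y : S - h <= x -> x < y -> y <= S ->
    `|deriven_in 1 `[0, S] f y - deriven_in 1 `[0, S] f x| <= Q * h ^+ 2.
  move=> hx xy yS; have [z] := mvt 1%N x y isT hx xy yS.
  rewrite in_itv /= => /andP[xz zy] ->; rewrite expr2 mulrA normrM ler_pM //.
    by apply: f2; lra.
  by rewrite ger0_norm; lra.
have [|c ch DE] := mvt 0%N (S - h) S isT (lexx _) _ (lexx _); first lra.
have {DE} DE : D = deriven_in 1 `[0, S] f c.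
  rewrite /D; move: DE; rewrite {1 2}/deriven_in => ->.
  by rewrite opprB addrC subrK mulfK // gt_eqF.
move: ch; rewrite in_itv /= => /andP[ch cS]; rewrite DE; split; first by apply: f2; lra.
  by apply: f1; lra.
by rewrite distrC; apply: f1; lra.
Qed.

(** * Growth bounds from comparison *)

(** The comparison principle is applied to the doubled family of all [f i] and [- f i], indexed by
    [I * bool]; its largest member is the largest modulus. *)
Lemma norm_barrier (R : realType) (T N : R) (I : finType) (f f' : I -> R -> R) :
  0 <= T -> 0 <= N ->
  (forall i, {within `[0, T], continuous (f i)}) ->
  (forall i, f i 0 = 0) ->
  (forall i t, 0 < t <= T ->
     diff_quot (f i) t @ within `[0, T] t^' --> f' i t) ->
  (forall i t (c : bool), 0 < t <= T -> t * N <= (-1) ^+ c * f i t ->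
     (forall j, `|f j t| <= (-1) ^+ c * f i t) -> (-1) ^+ c * f' i t <= N) ->
  forall i t, 0 <= t <= T -> `|f i t| <= t * N.
Proof.
move=> T0 N0 fc f0 fd fb i t tT.
pose g (p : I * bool) t := (-1) ^+ p.2 * f p.1 t.
pose g' (p : I * bool) t := (-1) ^+ p.2 * f' p.1 t.
have H : forall p t, 0 <= t <= T -> g p t <= t * N.
  apply: (@barrier _ _ _ _ g g') => //.
  - move=> p x; apply: cvgM; first exact: cvg_cst.
    exact: fc.
  - by move=> p; rewrite /g f0 mulr0.
  - move=> p x xT.
    have -> : diff_quot (g p) x = (fun y => (-1) ^+ p.2 * diff_quot (f p.1) x y).
      apply/funext => y; rewrite /diff_quot /g -mulrBr.
      by rewrite -[LHS]/(_ * _) -[X in _ * X = _]/(_ * _) mulrCA.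
    by apply: cvgM; [exact: cvg_cst|exact: fd].
  - move=> [j c] x xT /= le1 le2; apply: fb => // k.
    have := le2 (k, false); have := le2 (k, true).
    by rewrite /g /= expr0 expr1 mul1r mulN1r ler_norml => ? ?; lra.
have := H (i, false) t tT; have := H (i, true) t tT.
by rewrite /g /= expr0 expr1 mul1r mulN1r ler_norml; lra.
Qed.

(** The function [d] grows at rate at most [G]. Where [e] reaches its barrier, the damping [- r * e]
    cancels the forcing [a * d], of size at most [a * t * G]; this fixes the summand [a * G / r] of
    the slope. *)
Lemma tail_bound (R : realType) (r a T G E : R) (e d e' d' : R -> R) :
  0 < r -> 0 <= a -> 0 < T ->
  {within `[0, T], continuous e} -> {within `[0, T], continuous d} ->
  e 0 = 0 -> d 0 = 0 ->
  (forall t, 0 < t <= T -> diff_quot e t @ within `[0, T] t^' --> e' t) ->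
  (forall t, 0 < t <= T -> diff_quot d t @ within `[0, T] t^' --> d' t) ->
  (forall t, 0 < t <= T -> `|d' t| <= G) ->
  (forall t, 0 < t <= T -> `|e' t + r * e t - a * d t| <= E) ->
  forall t, 0 <= t <= T ->
    `|d t| <= t * G /\ `|e t| <= t * (a * G / r + E).
Proof.
move=> r0 a0 T0 ec dc e0 d0 ed dd dG eE.
have TT : 0 < T <= T by rewrite T0 lexx.
have G0 : 0 <= G by exact: le_trans (dG T TT).
have E0 : 0 <= E by exact: le_trans (eE T TT).
have dB t : 0 <= t <= T -> `|d t| <= t * G.
  apply: (@norm_barrier _ T G unit (fun=> d) (fun=> d') _ _ _ _ _ _ tt) => //.
    exact: ltW.
  move=> _ x c xT _ _; apply: (le_trans (ler_norm _)).
  by rewrite normrM normr_sign mul1r dG.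
move=> t tT; split; first exact: dB.
have aGr : 0 <= a * G / r by rewrite divr_ge0 ?mulr_ge0 // ltW.
have aGE : a * G / r * r = a * G by rewrite divfK // gt_eqF.
move: t tT.
apply: (@norm_barrier _ T _ unit (fun=> e) (fun=> e') _ _ _ _ _ _ tt) => //.
- exact: ltW.
- exact: addr_ge0.
move=> _ x c xT le1 _.
have /andP[x0 xleT] := xT.
have -> : (-1) ^+ c * e' x = (-1) ^+ c * (e' x + r * e x - a * d x)
   - r * ((-1) ^+ c * e x) + a * ((-1) ^+ c * d x) by ring.
have H1 : (-1) ^+ c * (e' x + r * e x - a * d x) <= E.
  by apply: (le_trans (ler_norm _)); rewrite normrM normr_sign mul1r eE.
have H2 : (-1) ^+ c * d x <= x * G.
  apply: (le_trans (ler_norm _)); rewrite normrM normr_sign mul1r dB //; lra.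
have H3 : a * ((-1) ^+ c * d x) <= a * (x * G) by rewrite ler_wpM2l.
have H4 : r * (x * (a * G / r + E)) <= r * ((-1) ^+ c * e x).
  by rewrite ler_pM2l.
have H5 : r * (x * (a * G / r + E)) = a * (x * G) + r * (x * E).
  transitivity (x * (a * G / r * r) + r * (x * E)); first by ring.
  by rewrite aGE; ring.
have : 0 <= r * (x * E) by rewrite !mulr_ge0 // ltW.
lra.
Qed.

Lemma derive_in_mx (R : realType) (D : set R) (p q : nat)
    (f : R -> 'M[R]_(p, q)) (x : R) i j :
  ProperFilter (within D x^') ->
  (forall i j, derivable_in D (fun t => f t i j) x) ->
  derive_in D f x i j = derive_in D (fun t => f t i j) x.
Proof.
move=> PF df.
suff : diff_quot f x @ within D x^' -->
    (\matrix_(i, j) derive_in D (fun t => f t i j) x : 'M[R]_(p, q)).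
  by move=> /cvg_lim; rewrite /derive_in => -> //; rewrite mxE.
apply: cvg_mx => k l; rewrite mxE.
have -> : (fun y => diff_quot f x y k l) = diff_quot (fun t => f t k l) x.
  by apply/funext => y; rewrite /diff_quot !mxE.
exact: df.
Qed.

(** * Rows of the semidiscrete matrix *)

Section Rows.
Variables (R : realType) (m : nat) (r S : R) (s alpha beta gamma : nat -> R).
Let M := matM m r S s alpha beta gamma.
Let A := matA m alpha beta gamma.

Lemma matM_mul_head (v : 'cV[R]_(m + 2)) (i : 'I_m) :
  (M *m v) (lshift 2 i) 0 = \sum_j A i j * v (lshift 2 j) 0
    + (if i.+1 == m then gamma m else 0) * v (rshift m ord0) 0.
Proof.
rewrite -{1}(vsubmxK v) /M /matM mul_block_col col_mxEu !mxE; congr (_ + _).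
  by apply: eq_bigr => j _; rewrite !mxE.
rewrite !big_ord_recl big_ord0 /= !mxE /= andbT andbF mul0r !addr0.
by congr (_ * v _ _); apply: val_inj.
Qed.

(** The right-hand side does not depend on [k], so [M] drops out of the equation for the difference
    of the last two components. *)
Lemma matM_mul_tail (v : 'cV[R]_(m + 2)) (k : 'I_2) :
  (M *m v) (rshift m k) 0 = r / mesh s (m + 2) *
    (- S * v (rshift m ord0) 0 + s (m + 1)%N * v (rshift m ord_max) 0).
Proof.
rewrite -{1}(vsubmxK v) /M /matM mul_block_col col_mxEd mul0mx add0r /matC.
rewrite -scalemxAl !mxE !big_ord_recl big_ord0 /= !mxE /= addr0.
by congr (_ * (_ * v _ _ + _ * v _ _)); apply: val_inj.
Qed.

(** The first column of [B] is joined to [A]. All rows but the last are controlled by the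
    logarithmic norm of [r%:M + A]; the last, which alone meets [gamma m], by the separate
    hypothesis. *)
Lemma row_sum_augmented (i : 'I_m) :
  lognorm_inf (r%:M + A) <= 0 ->
  r + alpha m + `|beta m| + `|gamma m| <= 0 ->
  A i i + \sum_(j | j != i) `|A i j|
    + `|if i.+1 == m then gamma m else 0| <= - r.
Proof.
move=> logA last_row.
case: eqP => [im|_]; last first.
  have := row_sum_le_lognorm_inf (r%:M + A) i.
  rewrite (eq_bigr (fun j => `|A i j|)); last first.
    by move=> j ji; rewrite !mxE eq_sym (negbTE ji) mulr0n add0r.
  by rewrite mxE [in r%:M _ _]mxE eqxx normr0 mulr1n; lra.
have -> : A i i = alpha m by rewrite mxE eqxx im.
suff : \sum_(j | j != i) `|A i j| <= `|beta m| by lra.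
have Aij (j : 'I_m) : j != i ->
    A i j = if i == j.+1 :> nat then beta m else 0.
  move=> ji; rewrite mxE im val_eqE (negbTE ji).
  by case: eqP => // _; case: eqP => // jm; have := ltn_ord j; rewrite jm ltnn.
have [/existsP[j0 /eqP ij0]|no] := boolP [exists j : 'I_m, i == j.+1 :> nat].
  have j0i : j0 != i by rewrite -val_eqE /= ij0 neq_ltn ltnS leqnn.
  rewrite (bigD1 j0) //= big1 ?addr0; first by rewrite Aij // ij0 eqxx.
  move=> j /andP[ji jj0]; rewrite Aij // ij0 eqSS [_ == _ :> nat]eq_sym.
  by rewrite val_eqE (negbTE jj0) normr0.
rewrite big1 // => j ji; rewrite Aij //.
case: eqP => [ij|_]; last by rewrite normr0.
by case/negP: no; apply/existsP; exists j; apply/eqP.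
Qed.

End Rows.

(** * Truncation error at the last two grid points *)

(** Here [flux] is the common value of both rows of [C] on the exact solution. At either point u_t
    minus [flux] reduces to a multiple of u_s minus a difference quotient, with an extra diffusion
    term at [S - h]. *)
Lemma tail_truncation_bound (R : realType) (r sigma S T hstar h Q t : R)
    (u : R -> R -> R) (u0 g : R -> R) :
  0 <= r -> 0 < h <= hstar -> h < S -> 0 < t <= T ->
  black_scholes_solution r sigma S T u u0 g ->
  third_derivative_regular S T u hstar ->
  (forall x, x \in `[S - hstar, S] -> `|ds S u 3 x t| <= Q) ->
  let flux := r / h * (- S * u (S - h) t + (S - h) * u S t) in
  `|dt T u (S - h) t - flux|
    <= (2^-1 * sigma ^+ 2 * S ^+ 2 * h + r * S * h ^+ 2) * Q /\
  `|(dt T u S t - flux) - (dt T u (S - h) t - flux)|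
    <= (2^-1 * sigma ^+ 2 * S ^+ 2 * h + 2 * r * S * h ^+ 2) * Q.
Proof.
move=> r0 /andP[h0 hh] hS tT [pde _ _ lbc] [usss _] usssQ flux.
have tT' : t \in `]0, T] by rewrite in_itv.
have tTc : t \in `[0, T] by rewrite in_itv /=; lra.
have sub x : x \in `[S - h, S] -> x \in `[S - hstar, S].
  by rewrite !in_itv /=; lra.
have S0 : 0 < S by lra.
have [||||f2B f1B f1B'] := @linear_boundary_taylor R S h Q (u^~ t).
- by rewrite h0 ltW.
- by move=> x /sub xS; exact: usss.
- exact: lbc.
- by move=> x /sub; exact: usssQ.
set D := (u S t - u (S - h) t) / h in f1B f1B'.
rewrite -[deriven_in _ _ _ _]/(ds S u 2 (S - h) t) in f2B.
rewrite -[deriven_in _ _ _ _]/(ds S u 1 S t) in f1B.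
rewrite -[deriven_in _ _ _ _]/(ds S u 1 (S - h) t) in f1B'.
have hD : h * D = u S t - u (S - h) t by rewrite /D mulrC divfK // gt_eqF.
(* In this form the flux is the spatial operator at [S] with u_ss = 0 and with u_s replaced by
   [D]. *)
have fluxE : flux = r * S * D - r * u S t.
  have -> : flux = r / h * (S * (h * D) - h * u S t) by rewrite hD /flux; ring.
  by field; rewrite gt_eqF.
have d2E : dt T u S t - flux = r * S * (ds S u 1 S t - D).
  rewrite fluxE pde //; last by rewrite in_itv /= S0 lexx.
  by rewrite lbc //; ring.
have d1E : dt T u (S - h) t - flux =
    2^-1 * sigma ^+ 2 * (S - h) ^+ 2 * ds S u 2 (S - h) t
    + r * (S - h) * (ds S u 1 (S - h) t - D).
  rewrite fluxE pde //; last by rewrite in_itv /=; lra.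
  have -> : u S t = u (S - h) t + h * D by rewrite hD; ring.
  by ring.
have sg0 : 0 <= 2^-1 * sigma ^+ 2 by rewrite mulr_ge0 // sqr_ge0.
have Sh0 : 0 <= S - h by rewrite subr_ge0 ltW.
have Sh2 : (S - h) ^+ 2 <= S ^+ 2 by rewrite lerXn2r ?nnegrE ?gerBl // ltW.
have B1 : `|2^-1 * sigma ^+ 2 * (S - h) ^+ 2 * ds S u 2 (S - h) t|
    <= 2^-1 * sigma ^+ 2 * S ^+ 2 * (Q * h).
  rewrite normrM ler_pM // ger0_norm; first by rewrite ler_wpM2l.
  by rewrite mulr_ge0 // sqr_ge0.
have B2 : `|r * (S - h) * (ds S u 1 (S - h) t - D)| <= r * S * (Q * h ^+ 2).
  rewrite normrM ler_pM // ger0_norm ?(mulr_ge0 r0 Sh0) //.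
  by rewrite ler_wpM2l // gerBl ltW.
have B3 : `|r * S * (ds S u 1 S t - D)| <= r * S * (Q * h ^+ 2).
  by rewrite normrM ler_pM // ger0_norm // mulr_ge0 // ltW.
rewrite d1E d2E; split.
  apply: (le_trans (ler_normD _ _)); apply: (le_trans (lerD B1 B2)).
  by rewrite le_eqVlt; apply/orP; left; apply/eqP; ring.
apply: (le_trans (ler_normB _ _)).
apply: (le_trans (lerD B3 (le_trans (ler_normD _ _) (lerD B1 B2)))).
by rewrite le_eqVlt; apply/orP; left; apply/eqP; ring.
Qed.

(** * The error equation *)

Section ErrorEquation.
Variables (R : realType) (m : nat) (S T : R) (s : nat -> R).
Variables (u : R -> R -> R) (M : 'M[R]_(m + 2)) (b U : R -> 'cV[R]_(m + 2)).
Hypotheses (T0 : 0 < T).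
Hypothesis s_in : forall i : 'I_(m + 2), s i.+1 \in `]0, S].
Hypothesis ureg : regular_solution S T u.
Let uh t := grid_values m s (u^~ t).

Lemma grid_values_cvg t : t \in `[0, T] -> 
  uh @ within `[0, T] (nbhs t) --> uh t.
Proof.
move=> tT; apply: cvg_mx => i j; rewrite !mxE.
under eq_fun do rewrite mxE.
apply: derivable_in_continuous.
by case: ureg => /(_ _ _ (s_in i) tT) [].
Qed.

Lemma truncation_error_coord t i : t \in `[0, T] ->
  truncation_error T M b uh t i 0 =
  dt T u (s i.+1) t - (M *m uh t) i 0 - b t i 0.
Proof.
move=> tT; have PF := within_dnbhs_itv_proper T0 tT.
rewrite /truncation_error !mxE derive_in_mx //.
  by congr (derive_in _ _ _ - _ - _); apply/funext => x; rewrite mxE.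
move=> k l; under [X in derivable_in _ X]eq_fun do rewrite mxE.
by case: ureg => /(_ _ _ (s_in k) tT) [].
Qed.

(** This continuity serves to show that the maximum over time in the final bound is attained. *)
Lemma truncation_error_continuous : {within `[0, T], continuous b} ->
  {within `[0, T], continuous (truncation_error T M b uh)}.
Proof.
move=> bc; apply/subspace_continuousP => t tT.
apply: cvg_mx => i j; rewrite ord1 truncation_error_coord //.
have H : (fun x => dt T u (s i.+1) x - \sum_k M i k * uh x k 0 - b x i 0)
    @ within `[0, T] (nbhs t)
    --> dt T u (s i.+1) t - \sum_k M i k * uh t k 0 - b t i 0.
  apply: cvgB; last first.
    by apply: cvg_coord; move/subspace_continuousP : bc; exact.
  apply: cvgB; last first.
    apply: cvg_big => [|k _]; first exact: add_continuous.
    by apply: cvgM; [exact: cvg_cst|apply: cvg_coord; exact: grid_values_cvg].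
  case: ureg => _ /subspace_continuousP /(_ (s i.+1, t)) /= H _ _.
  have /H {}H : (`]0, S] `*` `[0, T])%classic (s i.+1, t) by split => //=.
  apply: (@cvg_comp _ _ _ (fun x => (s i.+1, x))
    (fun p => dt T u p.1 p.2) _ _ _ _ H) => P.
  rewrite /within /= => -[[A B] [/= HA HB] AB].
  apply: filterS HB => x Bx xT; apply: (AB (s i.+1, x)) => //.
    by split => //=; exact: nbhs_singleton.
  by split => //=; exact: s_in.
rewrite [(M *m _) i 0]mxE; apply: cvg_trans H.
apply: near_eq_cvg; rewrite near_withinE; apply: nearW => x xT.
by rewrite truncation_error_coord // mxE.
Qed.

Hypothesis Usol : semidiscrete_solution T M b (uh 0) U.
Let eps := discretization_error uh U.

Lemma discretization_error_continuous : {within `[0, T], continuous eps}.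
Proof.
apply/subspace_continuousP => t tT; apply: cvgB; first exact: grid_values_cvg.
by case: Usol => /subspace_continuousP + _ _; exact.
Qed.

Lemma discretization_error_derivative t i : 0 < t <= T ->
  diff_quot (fun x => eps x i 0) t @ within `[0, T] t^'
  --> (M *m eps t) i 0 + truncation_error T M b uh t i 0.
Proof.
move=> tT; have tTc : t \in `[0, T] by rewrite in_itv /=; lra.
have tTo : t \in `]0, T] by rewrite in_itv.
rewrite truncation_error_coord // /eps /discretization_error mulmxBr.
(* The term [M *m uh t] cancels, leaving u_t minus the right-hand side of the semidiscrete
   system. *)
have -> : (M *m uh t - M *m U t) i 0
    + (dt T u (s i.+1) t - (M *m uh t) i 0 - b t i 0)
    = dt T u (s i.+1) t - (M *m U t + b t) i 0.
  by rewrite !mxE; ring.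
case: Usol => _ /(_ t tTo)[Ud <-] _.
have -> : diff_quot (fun x => (uh x - U x) i 0) t =
    (fun y => diff_quot (u (s i.+1)) t y - diff_quot U t y i 0).
  by apply/funext => y; rewrite /diff_quot !mxE -[LHS]/(_ * _)
    -[X in _ = X - _]/(_ * _); ring.
apply: cvgB; last by apply: cvg_coord.
by case: ureg => /(_ _ _ (s_in i) tTc) [].
Qed.

End ErrorEquation.

(** * Estimates for the final assembly *)

(** At a component equal to the modulus bound [c], the diagonal entry keeps its sign and only the
    other entries are replaced by moduli, as in the logarithmic norm. *)
Lemma row_bound (R : realDomainType) (n : nat) (a v : 'I_n -> R) (b w c : R) i :
  (forall j, `|v j| <= c) -> `|w| <= c -> v i = c ->
  \sum_j a j * v j + b * w <= (a i + \sum_(j | j != i) `|a j| + `|b|) * c.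
Proof.
move=> vc wc vi; rewrite !mulrDl (bigD1 i) //= vi lerD //.
  rewrite lerD2l mulr_suml ler_sum // => j _.
  by rewrite (le_trans (ler_norm _)) // normrM ler_wpM2l.
by rewrite (le_trans (ler_norm _)) // normrM ler_wpM2l.
Qed.

(** The left side adds the growth rates, per unit bound on |u_sss|, of the penultimate component and
    of the difference of the last two. In its first term the factor 1/h from [C] cancels against a
    truncation factor of order h. *)
Lemma kappa_dominates (R : realType) (r sigma S h hstar : R) :
  0 < r -> 0 < h <= hstar -> h < S ->
  r * (S - h) / h * (2^-1 * sigma ^+ 2 * S ^+ 2 * h + 2 * r * S * h ^+ 2) / r
  + (2^-1 * sigma ^+ 2 * S ^+ 2 * h + r * S * h ^+ 2)
  + (2^-1 * sigma ^+ 2 * S ^+ 2 * h + 2 * r * S * h ^+ 2)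
  <= kappa_const r sigma S hstar.
Proof.
move=> r0 /andP[h0 hh] hS.
have hn0 : h != 0 by rewrite gt_eqF.
have rn0 : r != 0 by rewrite gt_eqF.
have -> : r * (S - h) / h
    * (2^-1 * sigma ^+ 2 * S ^+ 2 * h + 2 * r * S * h ^+ 2) / r =
    (S - h) * (2^-1 * sigma ^+ 2 * S ^+ 2 + 2 * r * S * h).
  by field; rewrite rn0.
rewrite /kappa_const.
have p0 : 0 <= sigma ^+ 2 * S ^+ 2 by rewrite mulr_ge0 ?sqr_ge0.
have S0 : 0 < S by exact: lt_trans hS.
have q0 : 0 < r * S by exact: mulr_gt0.
have H1 : sigma ^+ 2 * S ^+ 2 * h <= sigma ^+ 2 * S ^+ 2 * S.
  by rewrite ler_wpM2l // ltW.
have H2 : r * S * (h * h) <= r * S * (S * hstar).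
  by rewrite ler_pM2l // ler_pM // ltW.
have H3 : r * S * (S * h) <= r * S * (S * hstar) by rewrite !ler_pM2l.
have H4 : 0 <= r * S * (h * h) by rewrite mulr_ge0 ?mulr_ge0 // ltW.
have H5 : 0 <= sigma ^+ 2 * S ^+ 2 * h by rewrite mulr_ge0 // ltW.
have H6 : 0 <= r * S * (S * hstar).
  by rewrite mulr_ge0 ?mulr_ge0 // ltW // (lt_le_trans h0).
set p := sigma ^+ 2 * S ^+ 2 in p0 H1 H5.
set q := r * S in q0 H2 H3 H4 H6.
rewrite !exprS !expr0 in p p0 H1 H5 *.
have -> : (S - h) * (2^-1 * (sigma * (sigma * 1)) * (S * (S * 1)) + 2 * r * S * h)
  = 2^-1 * (p * S) - 2^-1 * (p * h) + 2 * (q * (S * h)) - 2 * (q * (h * h)).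
  by rewrite /p /q; field.
have -> : 2^-1 * (sigma * (sigma * 1)) * (S * (S * 1)) * h = 2^-1 * (p * h).
  by rewrite /p; field.
have -> : r * S * (h * (h * 1)) = q * (h * h) by rewrite /q; ring.
have -> : 2 * r * S * (h * (h * 1)) = 2 * (q * (h * h)) by rewrite /q; ring.
have -> : 4 * (sigma * (sigma * 1)) * (S * (S * (S * 1))) +
  6 * r * (S * (S * 1)) * hstar = 4 * (p * S) + 6 * (q * (S * hstar)).
  by rewrite /p /q; ring.
lra.
Qed.

Lemma grid_in (R : realType) (m : nat) (S : R) (s : nat -> R) :
  is_grid m S s -> forall i, (i < m + 2)%N -> s i.+1 \in `]0, S].
Proof.
move=> [s0 sS sm] i im.
have up j : (j <= m + 2)%N -> 0 <= s j.
  elim: j => [|j IH] jm; first by rewrite s0.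
  by apply: (le_trans (IH (ltnW jm))); exact/ltW/sm.
have down k : s (m + 2 - k)%N <= S.
  elim: k => [|k IH]; first by rewrite subn0 sS.
  apply: le_trans IH; rewrite subnS.
  case E : (m + 2 - k)%N => [//|j] /=; apply/ltW/sm.
  by rewrite -E leq_subr.
rewrite in_itv /= (le_lt_trans (up i (ltnW im)) (sm i im)) /=.
by have := down (m + 2 - i.+1)%N; rewrite subKn.
Qed.

Theorem theorem2 (R : realType) (m : nat) (r sigma S T : R)
  (s alpha beta gamma : nat -> R)
  (u : R -> R -> R) (u0 g : R -> R)
  (b U : R -> 'cV[R]_(m + 2)) (hstar : R) :
  let A := matA m alpha beta gamma in
  let M := matM m r S s alpha beta gamma in
  let h := mesh s in
  let uh := fun t => grid_values m s (u^~ t) in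
  let eps := discretization_error uh U in
  let delta := truncation_error T M b uh in
  let deltaL := fun t => usubmx (delta t) : 'cV[R]_m in
  (2 <= m)%N -> 0 < r -> 0 <= sigma -> 0 < S -> 0 < T ->
  is_grid m S s ->
  smooth_in `[0, S] u0 ->
  regular_solution S T u ->
  black_scholes_solution r sigma S T u u0 g ->
  {within `[0, T], continuous b} ->
  (forall t (i : 'I_(m + 2)), t \in `[0, T] -> (0 < i)%N -> b t i 0 = 0) ->
  semidiscrete_solution T M b (uh 0) U ->
  0 < hstar -> hstar <= S ->
  third_derivative_regular S T u hstar ->
  r%:M + A \in unitmx ->
  lognorm_inf (r%:M + A) <= 0 ->
  r + alpha m + `|beta m| + `|gamma m| <= 0 ->
  forall t, 0 < h (m + 2)%N <= hstar -> 0 < t <= T ->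
    `|eps t| <= t * max_on `[0, t]
      (fun theta => `|deltaL theta|
                    + kappa_const r sigma S hstar * eta_usss S u hstar theta).
Proof.
move=> A M h uh eps delta deltaL m2 r0 _ S0 T0 grid _ ureg bs bc bz Usol hs0 hsS
  usss _ logA last_row t hh /andP[t0 tT].
have s_in := grid_in grid.
have s_in' (i : 'I_(m + 2)) : s i.+1 \in `]0, S] by exact/s_in/ltn_ord.
set x1 := s (m + 1)%N.
have x10 : 0 < x1.
  have : s m.+1 \in `]0, S] by apply: s_in; rewrite addn2.
  by rewrite in_itv /x1 addn1 => /andP[].
have hE : h (m + 2)%N = S - x1.
  by rewrite /h /mesh; case: grid => _ -> _; rewrite addn2 /= -addn1.
rewrite hE in hh; have /andP[h0 hhs] := hh.
set hl := S - x1 in hh h0 hhs.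
have x1E : x1 = S - hl by rewrite /hl subKr.
have hlS : hl < S by rewrite /hl gtrBl.
have sub z : z \in `[0, t] -> z \in `[0, T].
  by rewrite !in_itv /= => /andP[-> zt]; exact: le_trans zt tT.
set K := kappa_const r sigma S hstar; set N := max_on _ _.
have K0 : 0 < K.
  apply: ltr_wpDl.
    exact: mulr_ge0 (mulr_ge0 (ler0n R 4) (sqr_ge0 sigma)) (exprn_ge0 3 (ltW S0)).
  exact: mulr_gt0 (mulr_gt0 (mulr_gt0 _ r0) (exprn_gt0 2 S0)) hs0.
have delta_c : {within `[0, t], continuous delta}.
  by apply: continuous_subspaceW sub _; exact: truncation_error_continuous.
(* The maximum defining [N] is attained by continuity, so [N] is no default value and dominates each
   pointwise expression. *)
have fib x z : x \in `[S - hstar, S] -> z \in `[0, t] ->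
    `|deltaL z| + K * `|ds S u 3 x z| <= N /\ `|deltaL z| <= N.
  apply: (@max_on_fibre R (S - hstar) S 0 t K (fun z => `|deltaL z|)
    (fun p => ds S u 3 p.1 p.2)).
  - by rewrite gerBl ltW.
  - exact: ltW.
  - exact: ltW.
  - apply/subspace_continuousP => y yt; apply: cvg_norm; apply: cvg_mx => i j.
    rewrite mxE; under eq_fun do rewrite mxE.
    by apply: cvg_coord; move/subspace_continuousP : delta_c; exact.
  - case: usss => _; apply: continuous_subspaceW => -[p1 p2] [/= p1S p2t].
    by split => //=; exact: sub.
have SS : S \in `[S - hstar, S] by rewrite in_itv /= lexx gerBl ltW.
have deltaLN z : z \in `[0, t] -> `|deltaL z| <= N by move=> /(fib S z SS)[].
have N0 : 0 <= N.
  by apply: le_trans (deltaLN 0 _); rewrite ?in_itv //= lexx ltW.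
(* [q] bounds |u_sss| on the boundary strip up to time [t]; all tail estimates are multiples of [q],
   to be compared with [N = K * q]. *)
set q := N / K.
have Kq : K * q = N by rewrite /q mulrC divfK // gt_eqF.
have q0 : 0 <= q by rewrite divr_ge0 // ltW.
have usssq x z : x \in `[S - hstar, S] -> z \in `[0, t] -> `|ds S u 3 x z| <= q.
  move=> xS zt; rewrite /q ler_pdivlMr // mulrC.
  by have [+ _] := fib x z xS zt; apply: le_trans; rewrite lerDr.
pose i1 : 'I_(m + 2) := rshift m ord0; pose i2 : 'I_(m + 2) := rshift m ord_max.
have si1 : s i1.+1 = x1 by rewrite /= addn0 /x1 addn1.
have si2 : s i2.+1 = S by case: grid => _ <- _; rewrite /= -addnS.
pose e i z := eps z i 0.
pose e' i z := (M *m eps z) i 0 + delta z i 0.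
have ec i : {within `[0, t], continuous (e i)}.
  apply/subspace_continuousP => z zt; apply: cvg_coord.
  have : {within `[0, t], continuous eps}.
    by apply: continuous_subspaceW sub _; exact: (discretization_error_continuous s_in' ureg Usol).
  by move/subspace_continuousP; exact.
have e0 i : e i 0 = 0.
  by rewrite /e /eps /discretization_error; case: Usol => _ _ ->; rewrite subrr mxE.
have ed i z : 0 < z <= t -> diff_quot (e i) z @ within `[0, t] z^' --> e' i z.
  move=> /andP[z0 zt].
  have zT : 0 < z <= T by rewrite z0 (le_trans zt).
  apply: cvg_trans (discretization_error_derivative T0 s_in' ureg Usol zT).
  by apply: cvg_app; exact: within_subset sub.
pose flux z := r / hl * (- S * u x1 z + x1 * u S z).
(* [b] vanishes in these rows, whose index is at least [m] and hence positive. *)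
have delta_tail k z : z \in `[0, T] ->
    delta z (rshift m k) 0 = dt T u (s (rshift m k : 'I_(m + 2)).+1) z - flux z.
  move=> zT; rewrite /delta (truncation_error_coord _ _ T0 s_in' ureg) // bz //; last first.
    by rewrite /= ltn_addr // (leq_trans _ m2).
  rewrite subr0; congr (_ - _); rewrite matM_mul_tail -/h hE -/hl -/x1 /flux.
  by rewrite !mxE -/i1 -/i2 si1 si2.
set G := 2^-1 * sigma ^+ 2 * S ^+ 2 * hl + 2 * r * S * hl ^+ 2.
set E := 2^-1 * sigma ^+ 2 * S ^+ 2 * hl + r * S * hl ^+ 2.
have trunc z : 0 < z <= t -> `|delta z i1 0| <= E * q /\
    `|delta z i2 0 - delta z i1 0| <= G * q.
  move=> /andP[z0 zt].
  have zT : 0 < z <= T by rewrite z0 (le_trans zt).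
  have zt' : z \in `[0, t] by rewrite in_itv /= ltW.
  have := tail_truncation_bound (ltW r0) hh hlS zT bs usss
    (fun x xS => usssq x z xS zt').
  by rewrite -x1E !delta_tail ?sub // -/i1 -/i2 si1 si2.
pose a := r * x1 / hl.
have a0 : 0 <= a by rewrite divr_ge0 ?mulr_ge0 // ltW.
(* Since [S = x1 + hl], a row of [C] splits into damping of [e i1] and coupling to the difference of
   the last two components. *)
have rowC k z : (M *m eps z) (rshift m k) 0
    = - r * e i1 z + a * (e i2 z - e i1 z).
  rewrite matM_mul_tail -/h hE -/hl -/x1 -/i1 -/i2 -/(e i1 z) -/(e i2 z) /a x1E.
  by field; rewrite gt_eqF.
have tail z : 0 <= z <= t -> `|e i2 z - e i1 z| <= z * (G * q) /\
    `|e i1 z| <= z * (a * (G * q) / r + E * q).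
  apply: (@tail_bound R r a t (G * q) (E * q) (e i1) (fun z => e i2 z - e i1 z)
    (e' i1) (fun z => e' i2 z - e' i1 z)) => //.
  - by move=> y; apply: cvgB; exact: ec.
  - by rewrite !e0 subrr.
  - exact: ed.
  - move=> y yt.
    have -> : diff_quot (fun z => e i2 z - e i1 z) y =
        (fun x => diff_quot (e i2) y x - diff_quot (e i1) y x).
      by apply/funext => x; rewrite /diff_quot -scalerBr; congr (_ *: _); ring.
    by apply: cvgB; exact: ed.
  - move=> y yt; rewrite /e' !rowC.
    by have [_] := trunc y yt; congr (`|_| <= _); ring.
  - move=> y yt; rewrite /e' rowC.
    by have [+ _] := trunc y yt; congr (`|_| <= _); ring.
(* The rates of [e i1] and of the difference sum to at most [N]; this serves both the barrier for
   [e i1] and the triangle inequality for the last component. *)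
have GEK : a * (G * q) / r + E * q + G * q <= N.
  rewrite -Kq.
  have := kappa_dominates sigma r0 hh hlS; rewrite -x1E -/G -/E -/K -/a.
  move=> /(ler_wpM2r q0); apply: le_trans.
  by rewrite le_eqVlt; apply/orP; left; apply/eqP; ring.
have tt0 : 0 < t <= t by rewrite t0 lexx.
have G0 : 0 <= G * q by case: (trunc t tt0) => _; exact: le_trans.
have E0 : 0 <= E * q by case: (trunc t tt0) => + _; exact: le_trans.
have aG0 : 0 <= a * (G * q) / r := divr_ge0 (mulr_ge0 a0 G0) (ltW r0).
have norm_sign c x : `|(-1) ^+ c * x| = `|x| :> R.
  by rewrite normrM normr_sign mul1r.
(* [None] stands for [e i1] and [Some i] for a head component; the rows of head components involve
   only members of this family. *)
have head : forall (o : option 'I_m) z, 0 <= z <= t ->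
    `|e (if o is Some i then lshift 2 i else i1) z| <= z * N.
  apply: (@norm_barrier R t N _ _
    (fun (o : option 'I_m) => e' (if o is Some i then lshift 2 i else i1))) => //.
  - exact: ltW.
  - by move=> o z zt; exact: ed.
  move=> o z c zt Nw ew; have /andP[z0 zt'] := zt.
  have zti : z \in `[0, t] by rewrite in_itv /= zt' ltW.
  set w := _ * e _ z in Nw ew.
  have w0 : 0 <= w by apply: le_trans Nw; rewrite mulr_ge0 // ltW.
  have rw0 : 0 <= r * w by rewrite mulr_ge0 // ltW.
  case: o @w Nw ew w0 rw0 => [i|] w Nw ew w0 rw0.
    rewrite /e' matM_mul_head !mulrDr.
    have -> : (-1) ^+ c * (\sum_j matA m alpha beta gamma i j
          * eps z (lshift 2 j) 0)
        = \sum_j A i j * ((-1) ^+ c * e (lshift 2 j) z).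
      by rewrite mulr_sumr; apply: eq_bigr => j _; rewrite mulrCA.
    rewrite mulrCA -/(e i1 z).
    have H1 := @row_bound R m (A i) (fun j => (-1) ^+ c * e (lshift 2 j) z)
      (if i.+1 == m then gamma m else 0) ((-1) ^+ c * e i1 z) w i.
    have H2 : (-1) ^+ c * delta z (lshift 2 i) 0 <= N.
      apply: (le_trans (ler_norm _)); rewrite norm_sign.
      apply: le_trans (deltaLN z zti); apply: le_trans (ler_mx_norm _ i 0).
      by rewrite /deltaL [usubmx _ _ _]mxE.
    have H3 := row_sum_augmented i logA last_row.
    have {}H3 := ler_wpM2r w0 H3; rewrite -/A mulNr in H3.
    apply: (le_trans (lerD (H1 _ _ _) H2)) => //.
    - by move=> j; rewrite norm_sign; exact: (ew (Some j)).
    - by rewrite norm_sign; exact: (ew None).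
    - by move: H3 rw0; set p := _ * w; set p' := r * w; lra.
  have [dB _] := tail z (introT andP (conj (ltW z0) zt')).
  have [dd1 _] := trunc z zt.
  rewrite /e' rowC mulrDr.
  have H1 : (-1) ^+ c * delta z i1 0 <= E * q.
    by apply: (le_trans (ler_norm _)); rewrite norm_sign.
  have H2 : (-1) ^+ c * (e i2 z - e i1 z) <= z * (G * q).
    by apply: (le_trans (ler_norm _)); rewrite norm_sign.
  (* At the barrier [w] is at least [z * N], so the damping [r * w] absorbs the coupling term and
     only [E * q], at most [N], remains. *)
  have H3 : a * ((-1) ^+ c * (e i2 z - e i1 z)) <= r * (z * N).
    apply: (le_trans (ler_wpM2l a0 H2)).
    have -> : a * (z * (G * q)) = r * (z * (a * (G * q) / r)).
      by field; rewrite gt_eqF.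
    by rewrite !ler_pM2l //; lra.
  have H4 : r * (z * N) <= r * w by rewrite ler_pM2l.
  have -> : (-1) ^+ c * (- r * e i1 z + a * (e i2 z - e i1 z))
    = - (r * w) + a * ((-1) ^+ c * (e i2 z - e i1 z)) by rewrite /w; ring.
  by lra.
have tt : 0 <= t <= t by rewrite lexx ltW.
apply/mx_norm_leP; first by rewrite mulr_ge0 // ltW.
move=> i j; rewrite ord1 -/(e i t).
case: (split_ordP i) => [k ->|k ->]; first exact: (head (Some k) t tt).
case: (unliftP ord0 k) => [k' ->|->]; last exact: (head None t tt).
have -> : rshift m (lift ord0 k') = i2 by rewrite ord1; apply: val_inj.
have [dB eB] := tail t tt.
have -> : e i2 t = e i1 t + (e i2 t - e i1 t) by rewrite addrCA subrr addr0.
apply: (le_trans (ler_normD _ _)); apply: (le_trans (lerD eB dB)).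
by rewrite -mulrDr ler_pM2l.
Qed.
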